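(* Let $(X,\odot,{}^*,1)$ be a (left-)quantum-MV algebra satisfying, for all $x,y,z\in X$, $$x\odot (y\odot z)=(x\odot y^* )^*\odot (x\odot z).$$ Then $X$ is an MV algebra.
   Context: An involutive left-m-BE algebra is an algebra $(X,\odot,{}^*,1)$ of type $(2,1,0)$ such that, with $0:=1^*$, for all $x,y,z\in X$: $1\odot x=x=x\odot 1$; $x\odot y=y\odot x$; $x\odot(y\odot z)=(x\odot y)\odot z$; $x\odot 0=0$; $x\odot x^*=0$; $x^{**}=x$. In it put $x\wedge_m^M y:=(x^*\odot y)^*\odot y$ and $x\vee_m^M y:=(x^*\wedge_m^M y^* )^*$. A (left-)quantum-MV algebra is an involutive left-m-BE algebra satisfying $x\odot((x^*\vee_m^M y)\vee_m^M(z\vee_m^M x^* ))=(x\odot y)\vee_m^M(x\odot z)$ for all $x,y,z\in X$. A (left-)MV algebra is an involutive left-m-BE algebra satisfying $(x^*\odot y)^*\odot y=(y^*\odot x)^*\odot x$ for all $x,y\in X$. *)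

(* Defs.v *)
Set Implicit Arguments.
Unset Strict Implicit.
Unset Printing Implicit Defensive.

(* Algebras of type (2,1,0). *)
Record algebra : Type := Algebra {
  carrier :> Type;
  odot : carrier -> carrier -> carrier;
  star : carrier -> carrier;
  one : carrier
}.

Arguments one {X} : rename.

Declare Scope mbe_scope.
Delimit Scope mbe_scope with mbe.

Notation "x ⊙ y" := (odot x y) (at level 40, left associativity) : mbe_scope.
Notation "x ^*" := (star x) (at level 2, left associativity, format "x ^*") : mbe_scope.
Notation "1" := one : mbe_scope.

Local Open Scope mbe_scope.

Definition zero {X : algebra} : X := 1^*.
Notation "0" := zero : mbe_scope.

Definition meetM (X : algebra) (x y : X) : X := (x^* ⊙ y)^* ⊙ y.
Notation "x ∧ₘ y" := (meetM x y) (at level 45, no associativity) : mbe_scope.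

Definition joinM (X : algebra) (x y : X) : X := (x^* ∧ₘ y^*)^*.
Notation "x ∨ₘ y" := (joinM x y) (at level 50, no associativity) : mbe_scope.

Record involutive_left_mBE (X : algebra) : Prop := {
  odot1x : forall x : X, 1 ⊙ x = x;
  odotx1 : forall x : X, x ⊙ 1 = x;
  odotC : forall x y : X, x ⊙ y = y ⊙ x;
  odotA : forall x y z : X, x ⊙ (y ⊙ z) = (x ⊙ y) ⊙ z;
  odotx0 : forall x : X, x ⊙ 0 = 0;
  odotxN : forall x : X, x ⊙ x^* = 0;
  starK : forall x : X, x^*^* = x
}.

Record quantum_MV (X : algebra) : Prop := {
  quantum_MV_mBE :> involutive_left_mBE X;
  quantum_MV_axiom : forall x y z : X,
    x ⊙ ((x^* ∨ₘ y) ∨ₘ (z ∨ₘ x^*)) = (x ⊙ y) ∨ₘ (x ⊙ z)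
}.

Record MV (X : algebra) : Prop := {
  MV_mBE :> involutive_left_mBE X;
  MV_axiom : forall x y : X, (x^* ⊙ y)^* ⊙ y = (y^* ⊙ x)^* ⊙ x
}.

(* Main.v *)
(** At [z = 1] the hypothesis says that [y ∧ₘ x = x ⊙ y], so [∧ₘ] inherits the commutativity of [⊙]. *)
Require Import Defs.
Local Open Scope mbe_scope.

Theorem theorem5p15 (X : algebra) (hX : quantum_MV X)
  (himpl : forall x y z : X, x ⊙ (y ⊙ z) = (x ⊙ y^*)^* ⊙ (x ⊙ z)) :
  MV X.
Proof.
  assert (hm := quantum_MV_mBE hX).
  assert (meetE : forall x y : X, (x^* ⊙ y)^* ⊙ y = y ⊙ x).
  { intros x y.
    assert (h := himpl y x 1).
    rewrite !(odotx1 hm) in h.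
    rewrite (odotC hm x^* y).
    symmetry; exact h. }
  split; [exact hm |].
  intros x y.
  (* The two sides of the MV identity are [x ∧ₘ y] and [y ∧ₘ x] unfolded, so they become [y ⊙ x] and
     [x ⊙ y]. *)
  rewrite !meetE.
  apply (odotC hm).
Qed.
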